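(* Let $G=(V_G,E_G)$ be a finite graph of maximum degree $\Delta\ge 1$. Suppose that the hard-core model on $G$ at fugacity $\lambda>0$ has local $(\beta,\gamma)$-occupancy for some $\beta,\gamma>0$, and that for an integer $q>0$ there is some integer $d\ge\frac{2}{e}\log(2e\Delta^3)$ such that $$\frac{1+\lambda}{\beta\lambda}(q-\gamma\Delta)\ge 4ed$$ and $$\max_{u\in V_G}\ \max_{\substack{F\subseteq G[N(u)],\\ |V(F)|=d}}\frac{1}{Z_F(\lambda)}\le\frac{1}{2eq\Delta^3}.$$ Then $\chi(G)\le q$.
   Context: Logarithms are natural and $e$ is their base. $N(u)$ is the set of neighbours of $u$ and $G[N(u)]$ the subgraph it induces; $F\subseteq G[N(u)]$ ranges over subgraphs. If there is no such $F$ for a given $u$, the inner maximum is taken to be $0$. For a finite graph $F$, $Z_F(\lambda)=\sum_J\lambda^{|J|}$, summing over all independent sets $J$ of $F$ (including $\varnothing$), and $Z_F'$ is the derivative in $\lambda$. The hard-core model on $G$ at fugacity $\lambda$ is the distribution on independent sets giving $I$ probability $\lambda^{|I|}/Z_G(\lambda)$. It has local $(\beta,\gamma)$-occupancy if, for each $u\in V_G$ and each induced subgraph $F$ of $G[N(u)]$ (including the graph with no vertices, for which $Z_F=1$), $$\beta\,\frac{\lambda}{1+\lambda}\,\frac{1}{Z_F(\lambda)}+\gamma\,\frac{\lambda Z_F'(\lambda)}{Z_F(\lambda)}\ge 1.$$ $\chi(G)$ is the chromatic number of $G$. *)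

(* Defs.v *)
From HB Require Import structures.
From mathcomp Require Import all_boot all_order all_algebra.
From mathcomp Require Import reals.
Set Implicit Arguments.
Unset Strict Implicit.
Unset Printing Implicit Defensive.
Import Order.TTheory GRing.Theory Num.Theory.

(* A simple graph whose vertex set is an arbitrary subset of the ambient      *)
(* finite type T, so that a graph and its subgraphs have the same type, and   *)
(* maxima over subgraphs are finite big operators.                            *)
Record graph (T : finType) := Graph {
  graph_val : {set T} * {set {set T}};
  graphP : [forall e in graph_val.2, (e \subset graph_val.1) && (#|e| == 2)]
}.

HB.instance Definition _ (T : finType) := [isSub for @graph_val T].
HB.instance Definition _ (T : finType) := [Finite of graph T by <:].

Section Graphs.
Variable T : finType.
Implicit Types (G F H : graph T) (W J : {set T}) (u : T).

Definition vset G : {set T} := (graph_val G).1.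
Definition eset G : {set {set T}} := (graph_val G).2.

Definition nbhd G u : {set T} := [set v | [set u; v] \in eset G].

Definition max_degree G : nat := \max_(u in vset G) #|nbhd G u|.

Definition subgraph F H : bool :=
  (vset F \subset vset H) && (eset F \subset eset H).

Lemma induced_proof H W :
  [forall e in [set e in eset H | e \subset W],
    (e \subset W :&: vset H) && (#|e| == 2)].
Proof.
apply/forall_inP => e; rewrite inE => /andP[eH eW].
have /andP[eV e2] := forall_inP (graphP H) e eH.
by rewrite subsetI eW eV e2.
Qed.

Definition induced H W : graph T :=
  @Graph T (W :&: vset H, [set e in eset H | e \subset W]) (induced_proof H W).

Definition independent F J : bool :=
  (J \subset vset F) && [forall e in eset F, ~~ (e \subset J)].

Definition colorable G (k : nat) : bool :=
  [exists f : {ffun {x : T | x \in vset G} -> 'I_k},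
    [forall x, forall y, ([set val x; val y] \in eset G) ==> (f x != f y)]].

Lemma colorable_ex G : exists k, colorable G k.
Proof.
exists #|{: {x : T | x \in vset G}}|.
apply/existsP; exists [ffun x => enum_rank x].
apply/forallP => x; apply/forallP => y; apply/implyP => xyE.
rewrite !ffunE (inj_eq enum_rank_inj); apply/eqP => xy; subst y.
have /andP[_] := forall_inP (graphP G) _ xyE.
by rewrite setUid cards1.
Qed.

Definition chromatic_number G : nat := ex_minn (colorable_ex G).

End Graphs.

Section HardCore.
Local Open Scope ring_scope.
Variables (R : realType) (T : finType).
Implicit Types (G F : graph T).

Definition indep_poly F : {poly R} :=
  \sum_(J : {set T} | independent F J) 'X^#|J|.

Definition local_occupancy G (lambda beta gamma : R) : Prop :=
  forall (u : T) (W : {set T}), u \in vset G -> W \subset nbhd G u ->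
    let Z := indep_poly (induced (induced G (nbhd G u)) W) in
    1 <= beta * (lambda / (1 + lambda)) * (1 / Z.[lambda])
         + gamma * (lambda * Z^`().[lambda] / Z.[lambda]).

(* The default value 0 is the convention for an empty inner maximum; it does  *)
(* not affect nonempty ones, as 1 / Z_F(lambda) > 0 for lambda > 0.           *)
Definition max_inv_Z G (d : nat) (lambda : R) : R :=
  \big[Num.max/0]_(u in vset G)
    \big[Num.max/0]_(F : graph T | subgraph F (induced G (nbhd G u))
                                   && (#|vset F| == d))
      (1 / (indep_poly F).[lambda]).

End HardCore.

(* Main.v *)
From mathcomp Require Import all_classical all_analysis.
Require Import Defs.
From HB Require Import structures.
From mathcomp Require Import all_boot all_order all_algebra.
From mathcomp Require Import reals sequences exp.
From mathcomp Require Import zify ring lra.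
Set Implicit Arguments.
Unset Strict Implicit.
Unset Printing Implicit Defensive.
Import Order.TTheory GRing.Theory Num.Theory.
Local Open Scope ring_scope.

(* Take a random proper partial q-colouring f of G, weighted by               *)
(* lambda^(number of coloured vertices). At a vertex u, the palette consists  *)
(* of the colours not used on N(u). Call u bad if its palette has fewer than  *)
(* 2ed colours, or if some colour of the palette is still available at d or   *)
(* more uncoloured neighbours of u. When no vertex is bad, the uncoloured     *)
(* vertices are coloured from their palettes (palettes of size >= 4d, each    *)
(* colour shared with at most d neighbours), by Rosenfeld's counting.         *)
(*                                                                            *)
(* A colouring without bad vertices exists by the lopsided local lemma, since *)
(* u is bad with probability at most 1/(e Delta^3) given f outside N(u):      *)
(* - Given everything but the neighbours of u coloured c, those form a        *)
(*   hard-core sample on a subgraph F of G[N(u)], and c stays in the palette  *)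
(*   with probability 1/Z_F. This bounds the second kind of badness, and with *)
(*   local occupancy shows that the palette has mean size >= mu = 4ed.        *)
(* - The same bound on the mean holds when the measure is tilted by           *)
(*   s^|palette| for s in [0, 1], i.e. P(s) = E s^|palette| has P' >= mu P.   *)
(*   Hence P(s) <= exp(-(1 - s) mu), and s = exp(-1/2) gives probability at   *)
(*   most exp(-mu/8) for the first kind of badness.                           *)

(** Two things make this outline work. The first is independence: badness at vertices outside
    [near3 u] may be correlated with badness at [u], but by [bad_local] it is determined by the
    colours off N(u), and [bad_wt] bounds badness at [u] given any event of that sort. [local_lemma]
    asks for no more.

    The second is the budget. By [card_near3] each vertex depends on at most Delta^3 - 1 others, so
    a failure probability of 1/(e Delta^3) is affordable. [small_palette] takes half: its bound
    exp(-mu/8) = exp(-ed/2) is at most 1/(2e Delta^3) by the lower bound on d. [many_blank] takes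
    the other half: a union bound over q colours, each costing at most 1/(2eq Delta^3).
    [list_coloring] then completes a partial colouring without bad vertices.

    For Delta = 1 the bound on [near3] fails. There local occupancy of the empty graph gives q >= 4,
    and [list_coloring] colours G directly. *)

Section LocalLemma.
Variables (R : realFieldType) (Omega I : finType).
Variables (w : Omega -> R) (B : I -> pred Omega).
Hypothesis w_ge0 : forall o, 0 <= w o.

Definition avoid (S : {set I}) (o : Omega) := [forall v in S, ~~ B v o].

Definition avoid_wt S := \sum_(o | avoid S o) w o.

Lemma avoidU1 u S o : avoid (u |: S) o = ~~ B u o && avoid S o.
Proof.
apply/forall_inP/andP => [h|[hu /forall_inP h] v].
  split; first by apply: h; rewrite setU11.
  by apply/forall_inP => v vS; apply: h; rewrite setU1r.
by case/setU1P => [->|/h].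
Qed.

Lemma avoid_wt_ge0 S : 0 <= avoid_wt S.
Proof. by apply: sumr_ge0. Qed.

Lemma avoid_wtU1 u S :
  avoid_wt (u |: S) = avoid_wt S - \sum_(o | avoid S o && B u o) w o.
Proof.
rewrite /avoid_wt (bigID (B u) (avoid S)) /= addrC addrK.
by apply: eq_bigl => o; rewrite avoidU1 andbC.
Qed.

Variables (V : {set I}) (Gam : I -> {set I}) (D : nat) (x p : R).
Hypotheses (x_gt0 : 0 < x) (x_le1 : x <= 1).
Hypothesis p_le : p <= (1 - x) * x ^+ D.
Hypothesis card_Gam : forall u, u \in V -> (#|Gam u| <= D)%N.
Hypothesis B_wt : forall u (S : {set I}),
  u \in V -> S \subset V -> u \notin S -> [disjoint S & Gam u] ->
  \sum_(o | avoid S o && B u o) w o <= p * avoid_wt S.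

(** Here x bounds from below the conditional probability of avoiding [B u]. Remove [Gam u] from S to
    get K: the weight of [B u] is then at most p times that of avoiding K. Putting back the at most
    D removed events costs a factor x each, by induction ([grow]), so [B u] takes at most a fraction
    p / x^D <= 1 - x of the weight. *)
Lemma avoid_wt_step n u (S : {set I}) :
  (#|S| < n)%N -> u \in V -> S \subset V -> u \notin S ->
  x * avoid_wt S <= avoid_wt (u |: S).
Proof.
elim: n u S => // n IHn u S; rewrite ltnS => leSn uV SV uS.
have grow (K : {set I}) : K \subset S ->
    x ^+ #|S :\: K| * avoid_wt K <= avoid_wt S.
  move: {2}#|_| (leqnn #|S :\: K|) => k.
  elim: k K => [|k IHk] K leK KS.
    move: leK; rewrite leqn0 => /eqP/cards0_eq /eqP; rewrite setD_eq0 => SK.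
    have -> : K = S by apply/eqP; rewrite eqEsubset KS.
    by rewrite setDv cards0 mul1r.
  have [SK0|[v]] := set_0Vmem (S :\: K).
    by apply: IHk => //; rewrite SK0 cards0.
  move=> vSK; have /setDP[vS vK] := vSK.
  have e1 : (S :\: (v |: K)) = (S :\: K) :\ v.
    by apply/setP => z; rewrite !inE negb_or andbA.
  rewrite (cardsD1 v) vSK -e1 add1n exprS -mulrA mulrCA.
  have vKS : v |: K \subset S by rewrite subUset sub1set vS.
  apply: le_trans (IHk _ _ vKS); last first.
    by move: leK; rewrite (cardsD1 v) vSK -e1.
  apply: ler_wpM2l; first by rewrite exprn_ge0 // ltW.
  apply: (IHn _ _ _ (subsetP SV v vS) (subset_trans KS SV) vK).
  by move: (subset_leq_card vKS); rewrite cardsU1 vK add1n => /leq_trans->.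
rewrite avoid_wtU1 lerBrDr -lerBrDl.
set K := S :\: Gam u.
have KS : K \subset S by apply: subsetDl.
apply: (@le_trans _ _ (p * avoid_wt K)).
  apply: le_trans (B_wt uV (subset_trans KS SV) _ _).
  - rewrite big_mkcond [leRHS]big_mkcond; apply: ler_sum => o _.
    have [/andP[hS ->]|_] := boolP (_ && _); last by case: ifP.
    rewrite andbT ifT //; apply/forall_inP=> v /(subsetP KS) vS.
    exact: (forall_inP hS).
  - by apply: contra uS => /(subsetP KS).
  - by rewrite -setI_eq0 /K setIDAC -setIDA setDv setI0.
have xD : x ^+ D <= x ^+ #|S :\: K|.
  apply: ler_wiXn2l; rewrite ?(ltW x_gt0) //.
  apply: leq_trans (card_Gam uV); apply: subset_leq_card.
  by rewrite setDDr setDv set0U subsetIr.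
apply: le_trans (_ : (1 - x) * (x ^+ #|S :\: K| * avoid_wt K) <= _).
  rewrite mulrA; apply: ler_wpM2r; first exact: avoid_wt_ge0.
  by apply: le_trans p_le _; apply: ler_wpM2l => //; rewrite subr_ge0.
rewrite -[X in _ <= X - _]mul1r -mulrBl.
by apply: ler_wpM2l; [rewrite subr_ge0|apply: grow].
Qed.

Lemma local_lemma : 0 < \sum_o w o ->
  exists2 o, 0 < w o & forall u, u \in V -> ~~ B u o.
Proof.
move=> w_gt0.
have avoid_gt0 n (S : {set I}) : #|S| = n -> S \subset V -> 0 < avoid_wt S.
  elim: n S => [|n IHn] S.
    move/cards0_eq=> -> _; rewrite /avoid_wt (eq_bigl xpredT) // => o.
    by apply/forall_inP => v; rewrite inE.
  move=> Sn SV; have [S0|[v vS]] := set_0Vmem S.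
    by rewrite S0 cards0 in Sn.
  rewrite -(setD1K vS) in SV *; rewrite -(setD1K vS) in Sn.
  move: Sn SV; rewrite cardsU1 !inE eqxx add1n subUset sub1set.
  move=> -[Sn] /andP[vV SV].
  apply: lt_le_trans (avoid_wt_step (ltnSn _) vV SV _); last first.
    by rewrite !inE eqxx.
  by rewrite mulr_gt0 // IHn.
have : avoid_wt V != 0 by rewrite gt_eqF // (avoid_gt0 _ _ erefl).
rewrite /avoid_wt => /eqP h.
have [/existsP[z /andP[zV wz]]|] := boolP [exists o, avoid V o && (0 < w o)].
  by exists z => // u uV; apply: (forall_inP zV).
rewrite negb_exists => /forallP h2; case: h; apply: big1 => o oV.
by apply/eqP; move: (h2 o); rewrite oV lt0r w_ge0 andbT negbK.
Qed.

End LocalLemma.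

(** * List colouring by Rosenfeld's counting *)

Section ListColoring.
Variables (T C : finType) (e : rel T) (L : T -> {set C}) (U : {set T}).
Variables (d : nat) (c0 : C).
Hypotheses (e_sym : symmetric e) (d_gt0 : (0 < d)%N).
Hypothesis L_large : forall v, v \in U -> (4 * d <= #|L v|)%N.
Hypothesis L_sparse : forall v c, v \in U -> c \in L v ->
  (#|[set w in U | e v w && (c \in L w)]| <= d)%N.

Definition upd (f : {ffun T -> C}) v c := [ffun z => if z == v then c else f z].

(* Colourings of S are total functions taking the dummy value c0 outside S.   *)
Definition colorings (S : {set T}) := [set f : {ffun T -> C} |
  [forall v, if v \in S then f v \in L v else f v == c0] &&
  [forall v in S, forall w in S, e v w ==> (f v != f w)]].

Lemma coloringsP (S : {set T}) (f : {ffun T -> C}) :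
  reflect [/\ forall v, v \in S -> f v \in L v,
              forall v, v \notin S -> f v = c0 &
              forall v w, v \in S -> w \in S -> e v w -> f v != f w]
          (f \in colorings S).
Proof.
rewrite inE; apply: (iffP andP) => [[/forallP h1 /forall_inP h2]|[h1 h2 h3]].
  split=> [v vS|v vS|v w vS wS].
  - by move: (h1 v); rewrite vS.
  - by move: (h1 v); rewrite (negPf vS) => /eqP.
  - by move/forall_inP: (h2 v vS) => /(_ w wS)/implyP.
split; first by apply/forallP => v; case: ifPn => [/h1|/h2 ->].
apply/forall_inP => v vS; apply/forall_inP => w wS; apply/implyP; exact: h3.
Qed.

Lemma colorings_upd (S : {set T}) v f c : v \notin S -> f \in colorings S ->
  irreflexive e -> c \in L v ->
  (forall w, w \in S -> e v w -> f w != c) -> upd f v c \in colorings (v |: S).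
Proof.
move=> vS /coloringsP[h1 h2 h3] e_irr cL hc; apply/coloringsP; split.
- by move=> z; rewrite !inE ffunE; case: eqP => [->|_ /h1].
- by move=> z; rewrite !inE ffunE; case: eqP => [//|_ /h2].
move=> y z; rewrite !inE !ffunE; case: (eqVneq y v) => [->|_] /=.
  by case: (eqVneq z v) => [->|_] /= _; rewrite ?e_irr // eq_sym; apply: hc.
case: (eqVneq z v) => [->|_] /= yS; last exact: h3.
by rewrite e_sym => _; apply: hc.
Qed.

Lemma colorings_erase (S : {set T}) v c f : v \in S -> f \in colorings S ->
  f v = c -> upd f v c0 \in colorings (S :\ v) /\ f = upd (upd f v c0) v c.
Proof.
move=> vS /coloringsP[h1 h2 h3] fv; split; last first.
  by apply/ffunP=> z; rewrite !ffunE; case: eqP => // ->.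
apply/coloringsP; split.
- by move=> z; rewrite !inE ffunE; case: eqP => //= _ /h1.
- by move=> z; rewrite !inE ffunE; case: eqP => //= _ /h2.
move=> y z; rewrite !inE !ffunE; case: eqP => //= _; case: eqP => //= _.
exact: h3.
Qed.

Lemma card_colorings_at (S : {set T}) v c : v \in S ->
  (#|[set f in colorings S | f v == c]| <= #|colorings (S :\ v)|)%N.
Proof.
move=> vS; rewrite -(@card_in_imset _ _ (fun f => upd f v c0)); last first.
  move=> f g; rewrite !inE => /andP[_ /eqP fv] /andP[_ /eqP gv] /ffunP h.
  apply/ffunP => z; have := h z; rewrite !ffunE; case: eqP => // -> _.
  by rewrite fv gv.
apply: subset_leq_card; apply/subsetP => _ /imsetP[f + ->].
by rewrite inE => /andP[fS /eqP fv]; have [] := colorings_erase vS fS fv.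
Qed.

Hypothesis e_irr : irreflexive e.

(** Extensions to v are counted as pairs of a colouring of S and a colour not blocked by a
    neighbour. By induction a given neighbour w has a given colour c in at most 1/(2d) of the
    colourings, and at most d neighbours can have c. So at most half of all pairs are blocked, which
    leaves on average at least half of the 4d colours. *)
Lemma card_colorings_step n (S : {set T}) v : (#|S| < n)%N -> S \subset U ->
  v \in U -> v \notin S ->
  (2 * d * #|colorings S| <= #|colorings (v |: S)|)%N.
Proof.
elim: n S v => // n IHn S v; rewrite ltnS => leSn SU vU vS.
pose bad f := [set c in L v | [exists w in S, e v w && (f w == c)]].
pose good f := L v :\: bad f.
have -> : (#|colorings (v |: S)| = \sum_(f in colorings S) #|good f|)%N.
  transitivity (\sum_(f in colorings S) \sum_(c in good f) 1)%N; last first.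
    by apply: eq_bigr => f _; rewrite sum1_card.
  rewrite pair_big_dep /= -sum1_card.
  (* A colouring of [v |: S] corresponds to its restriction to S, with v reset to [c0], together
     with its colour at v. *)
  rewrite (reindex_onto (fun fc : {ffun T -> C} * C => upd fc.1 v fc.2)
            (fun g => (upd g v c0, g v))) /=.
    apply: eq_bigl => -[f c] /=.
    rewrite xpair_eqE; apply/andP/andP.
      move=> [h /andP[/eqP h1 /eqP h2]].
      have [hS _] := @colorings_erase (v |: S) v c _ (setU11 _ _) h h2.
      rewrite h1 setU1K // in hS; split=> //.
      have /coloringsP[g1 _ g3] := h.
      rewrite !inE negb_and.
      have -> : c \in L v by rewrite -h2; apply: g1; rewrite setU11.
      rewrite /= andbT negb_exists; apply/forallP => z.
      have [zS|//] := boolP (z \in S); rewrite /= negb_and.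
      have [evz|//] := boolP (e v z).
      have := g3 v z (setU11 _ _) (setU1r _ zS) evz.
      rewrite !ffunE eqxx (negPf (_ : z != v)); first by rewrite eq_sym.
      by apply: contraNneq vS => <-.
    case=> hS; rewrite inE => /andP[]; rewrite inE => cb cL.
    split; last first.
      rewrite ffunE eqxx eqxx andbT; apply/eqP/ffunP => z; rewrite !ffunE.
      by case: eqP => // ->; move/coloringsP: hS => [_ /(_ v vS) ->].
    apply: colorings_upd => // z zS evz; apply: contra cb => fz.
    by rewrite cL; apply/existsP; exists z; rewrite zS evz.
  move=> g _; apply/ffunP => z; rewrite !ffunE.
  by case: eqP => // ->.
have sum_bad : (2 * \sum_(f in colorings S) #|bad f|
                <= #|L v| * #|colorings S|)%N.
  (* The extra factor d produces the 2d that the induction hypothesis absorbs. *)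
  rewrite -(leq_pmul2l d_gt0) mulnA [(d * 2)%N]mulnC.
  apply: (@leq_trans (\sum_(c in L v)
     \sum_(w in [set w in U | e v w && (c \in L w)]) #|colorings S|)%N);
    last first.
    rewrite -sum_nat_const big_distrr /=; apply: leq_sum => c cL.
    rewrite sum_nat_const; apply: leq_mul => //; exact: L_sparse.
  apply: (@leq_trans (2 * d * \sum_(c in L v)
     \sum_(w in [set w in U | e v w && (c \in L w)] | w \in S)
       #|[set f in colorings S | f w == c]|)%N).
    rewrite leq_mul2l; apply/orP; right.
    under eq_bigr => f _ do rewrite -sum1_card.
    rewrite (exchange_big_dep (mem (L v))) /=; last first.
      by move=> f c _; rewrite inE => /andP[].
    apply: leq_sum => c cL.
    under [leqRHS]eq_bigr => z _ do rewrite -sum1_card.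
    rewrite (exchange_big_dep (mem (colorings S))) /=; last first.
      by move=> z f _; rewrite inE => /andP[].
    rewrite big_mkcondr; apply: leq_sum => f fS.
    case: ifP => //; rewrite inE => /andP[_ /existsP[z /and3P[zS evz /eqP fz]]].
    rewrite (bigD1 z) //= !inE (subsetP SU z zS) evz zS /= andbT.
    move/coloringsP: (fS) => [/(_ z zS) + _ _]; rewrite fz => -> /=.
    by move: fS; rewrite !inE => ->; rewrite eqxx.
  rewrite big_distrr /=; apply: leq_sum => c cL.
  rewrite big_distrr /= big_mkcondr; apply: leq_sum => z _.
  case: ifP => // zS.
  apply: leq_trans (leq_mul (leqnn _) (card_colorings_at c zS)) _.
  rewrite -[in leqRHS](setD1K zS); apply: IHn; last by rewrite !inE eqxx.
  - by apply: leq_trans leSn; rewrite [leqRHS](cardsD1 z) zS.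
  - by apply: subset_trans SU; apply: subsetDl.
  - exact: (subsetP SU).
have sum_good : (\sum_(f in colorings S) #|good f| +
   \sum_(f in colorings S) #|bad f| = #|L v| * #|colorings S|)%N.
  rewrite -big_split /= mulnC -sum_nat_const; apply: eq_bigr => f _.
  have sb : bad f \subset L v by apply/subsetP=> c; rewrite inE => /andP[].
  by rewrite cardsD (setIidPr sb) subnK // subset_leq_card.
have := leq_mul (L_large vU) (leqnn #|colorings S|).
lia.
Qed.

Lemma list_coloring : exists f : {ffun T -> C},
  (forall v, v \in U -> f v \in L v) /\
  (forall v w, v \in U -> w \in U -> e v w -> f v != f w).
Proof.
have gt0 n (S : {set T}) : #|S| = n -> S \subset U -> (0 < #|colorings S|)%N.
  elim: n S => [|n IHn] S.
    move/cards0_eq=> -> _; apply/card_gt0P; exists [ffun=> c0].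
    by apply/coloringsP; split=> [v|v|v w]; rewrite ?ffunE ?inE.
  move=> Sn SU; have [S0|[v vS]] := set_0Vmem S.
    by rewrite S0 cards0 in Sn.
  rewrite -(setD1K vS) in SU *; rewrite -(setD1K vS) in Sn.
  move: Sn SU; rewrite cardsU1 !inE eqxx add1n subUset sub1set.
  move=> -[Sn] /andP[vV SV].
  apply: leq_trans (card_colorings_step (ltnSn _) SV vV _); last first.
    by rewrite !inE eqxx.
  by rewrite !muln_gt0 d_gt0 IHn.
have /card_gt0P[f /coloringsP[h1 _ h3]] := gt0 _ U erefl (subxx _).
by exists f.
Qed.

End ListColoring.

(** * Partition functions of the hard-core model *)

Section HardCoreSums.
Variables (R : realFieldType) (T : finType) (e : rel T) (lam : R).
Implicit Types (J W : {set T}).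

Definition stable J := [forall u in J, forall v in J, ~~ e u v].

Lemma stableP J :
  reflect (forall u v, u \in J -> v \in J -> ~~ e u v) (stable J).
Proof.
apply: (iffP forall_inP) => [h u v uJ vJ|h u uJ].
  exact: (forall_inP (h u uJ)).
by apply/forall_inP => v; apply: h.
Qed.

Lemma stable0 : stable set0.
Proof. by apply/stableP => u v; rewrite inE. Qed.

Definition hcZ W := \sum_(J : {set T} | (J \subset W) && stable J) lam ^+ #|J|.

(** This is lambda Z'(lambda), the unnormalised mean size of a hard-core sample. *)
Definition hcM W :=
  \sum_(J : {set T} | (J \subset W) && stable J) #|J|%:R * lam ^+ #|J|.

Hypothesis lam_gt0 : 0 < lam.

Lemma hcZE W : hcZ W =
  1 + \sum_(J : {set T} | [&& J \subset W, stable J & J != set0]) lam ^+ #|J|.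
Proof.
rewrite /hcZ (bigD1 set0) /= ?sub0set ?stable0 // cards0 expr0.
by under eq_bigl do rewrite -andbA.
Qed.

Lemma hcZ_ge1 W : 1 <= hcZ W.
Proof.
by rewrite hcZE lerDl; apply: sumr_ge0 => J _; rewrite exprn_ge0 // ltW.
Qed.

Lemma hcZ_gt0 W : 0 < hcZ W.
Proof. exact: lt_le_trans ltr01 (hcZ_ge1 W). Qed.

Lemma hcZS W W' : W \subset W' -> hcZ W <= hcZ W'.
Proof.
move=> sW; rewrite /hcZ big_mkcond [leRHS]big_mkcond; apply: ler_sum => J _.
have [/andP[JW ->]|_] := ifPn; first by rewrite (subset_trans JW).
by case: ifP => // _; rewrite exprn_ge0 // ltW.
Qed.

End HardCoreSums.

(** * Weighted partial colourings and resampling of one colour around a vertex *)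

Section PartialColorings.
Variables (R : realFieldType) (T C : finType) (e : rel T) (lam : R).
Hypotheses (e_sym : symmetric e) (e_irr : irreflexive e) (lam_gt0 : 0 < lam).

Local Notation pcol := {ffun T -> option C}.
Implicit Types (f g : pcol) (c : C) (u v : T) (J W : {set T}).

Definition nb u := [set v | e u v].

Definition proper_col f :=
  [forall u, forall v, e u v ==> (f u == None) || (f u != f v)].

Lemma proper_colP f :
  reflect (forall u v c, e u v -> f u = Some c -> f v <> Some c) (proper_col f).
Proof.
apply: (iffP forallP) => [h u v c euv fu fv|h u].
  by have /forallP/(_ v) := h u; rewrite euv fu fv eqxx.
apply/forallP => v; apply/implyP => euv.
case fu: (f u) => [c|] //=; apply/eqP => fv.
exact: (h u v c euv fu).
Qed.

Definition colored f := [set v | f v != None].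

(** Weight 0 for improper colourings lets every sum range over all functions. *)
Definition wt f := if proper_col f then lam ^+ #|colored f| else 0.

Definition avail f v c := [forall w in nb v, f w != Some c].

Definition palette f u := [set c | avail f u c].

Definition blank f u c := [set v in nb u | (f v == None) && avail f v c].

Definition paint c f J : pcol := [ffun v => if v \in J then Some c else f v].

Lemma wt_ge0 f : 0 <= wt f.
Proof. by rewrite /wt; case: ifP => // _; rewrite exprn_ge0 // ltW. Qed.

Lemma availP f v c :
  reflect (forall w, e v w -> f w <> Some c) (avail f v c).
Proof.
apply: (iffP forall_inP) => [h w evw|h w].
  by apply/eqP/h; rewrite inE.
by rewrite inE => /h/eqP.
Qed.

Lemma paint0 c f : paint c f set0 = f.
Proof. by apply/ffunP=> v; rewrite ffunE inE. Qed.

Section Resampling.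
Variables (u : T) (c : C).

Definition erase f : pcol :=
  [ffun v => if (v \in nb u) && (f v == Some c) then None else f v].

Definition stamp f := [set v in nb u | f v == Some c].

Lemma paint_erase f : paint c (erase f) (stamp f) = f.
Proof.
apply/ffunP=> v; rewrite !ffunE !in_set.
by case: (boolP (_ && _)) => // /andP[_ /eqP ->].
Qed.

Lemma palette_avail f : (c \in palette f u) = (stamp f == set0).
Proof.
rewrite in_set; apply/availP/eqP => [h|h w euw fw].
  by apply/setP => v; rewrite !inE; apply/negbTE/negP => /andP[/h + /eqP].
by have := in_set0 w; rewrite -h !in_set euw fw eqxx.
Qed.

(** This identifies the image of the decomposition of a proper colouring into the part without c on
    N(u) and the set of c-coloured neighbours. The available sets are exactly the stable subsets of
    [blank f u c], which is why a hard-core model appears. *)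
Lemma erase_paintP f J : proper_col (paint c f J) &&
    ((erase (paint c f J), stamp (paint c f J)) == (f, J)) =
  [&& proper_col f, c \in palette f u, J \subset blank f u c & stable e J].
Proof.
rewrite palette_avail xpair_eqE; apply/idP/idP.
  case/and3P => /proper_colP pr /eqP/ffunP er /eqP/setP st.
  have fJ v : v \in J -> (v \in nb u) /\ f v = None.
    move=> vJ; have := st v; have := er v.
    by rewrite /stamp in_set !ffunE vJ eqxx andbT => /[swap] -> <-.
  have fc v : v \in nb u -> f v <> Some c.
    move=> vu fv; have := er v; rewrite !ffunE vu fv.
    by rewrite if_same eqxx.
  apply/and4P; split.
  - apply/proper_colP => v w a evw fv fw.
    have vJ : v \notin J by apply/negP => /fJ[_]; rewrite fv.
    have wJ : w \notin J by apply/negP => /fJ[_]; rewrite fw.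
    by apply: (pr v w a evw); rewrite ffunE ?(negPf vJ) ?(negPf wJ).
  - apply/eqP/setP => v; rewrite in_set0 in_set; apply/negbTE/negP.
    by move=> /andP[/fc + /eqP].
  - apply/subsetP => v vJ; have [vu fv] := fJ v vJ.
    rewrite in_set vu fv /=; apply/availP => w evw fw.
    have wJ : w \notin J by apply/negP => /fJ[_]; rewrite fw.
    by apply: (pr v w c evw); rewrite ffunE ?vJ // (negPf wJ).
  - apply/stableP => v w vJ wJ; apply/negP => evw.
    by apply: (pr v w c evw); rewrite ffunE ?vJ ?wJ.
case/and4P => /proper_colP pr /eqP/setP st /subsetP JW /stableP Jst.
have JP v : v \in J -> [/\ v \in nb u, f v = None & avail f v c].
  by move/JW; rewrite in_set => /and3P[-> /eqP -> ->].
have nc v : v \in nb u -> (f v == Some c) = false.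
  by move=> vu; have := st v; rewrite in_set in_set0 vu.
apply/and3P; split.
- apply/proper_colP => v w a evw; rewrite !ffunE.
  have [vJ|vJ] := boolP (v \in J); have [wJ|wJ] := boolP (w \in J).
  + by have := Jst v w vJ wJ; rewrite evw.
  + by move=> -[<-]; have [_ _ /availP] := JP v vJ; apply.
  + move=> fv -[ca]; have [_ _ /availP/(_ v)] := JP w wJ; apply.
      by rewrite e_sym.
    by rewrite ca.
  + exact: pr.
- apply/eqP/ffunP => v; rewrite !ffunE; have [vJ|vJ] := boolP (v \in J).
    by have [-> -> _] := JP v vJ; rewrite eqxx.
  by case: ifP => // /andP[/nc ->].
- apply/eqP/setP => v; rewrite in_set ffunE; have [vJ|vJ] := boolP (v \in J).
    by have [-> _ _] := JP v vJ; rewrite eqxx.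
  by apply/negbTE/negP => /andP[/nc ->].
Qed.

Lemma blank_None f J v : J \subset blank f u c -> v \in J -> f v = None.
Proof. by move=> /subsetP JW /JW; rewrite in_set => /and3P[_ /eqP]. Qed.

Lemma card_colored_paint f J : J \subset blank f u c ->
  #|colored (paint c f J)| = (#|colored f| + #|J|)%N.
Proof.
move=> JW; have -> : colored (paint c f J) = colored f :|: J.
  apply/setP => v; rewrite !in_set ffunE orbC.
  by have [vJ|vJ] := boolP (v \in J).
rewrite cardsU; have -> : colored f :&: J = set0; last by rewrite cards0 subn0.
apply/setP => v; rewrite !in_set; apply/negbTE/negP => /andP[+ vJ].
by rewrite (blank_None JW vJ).
Qed.

Lemma palette_paint f J : c \in palette f u -> J \subset blank f u c ->
  palette (paint c f J) u = if J == set0 then palette f u else palette f u :\ c.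
Proof.
move=> cf JW; have [->|[x xJ]] := set_0Vmem J; first by rewrite paint0 eqxx.
case: ifPn => [/eqP J0|_]; first by rewrite J0 inE in xJ.
apply/setP => a; rewrite !inE; apply/availP/andP.
  move=> h; split.
    apply/eqP => ac; have := h x; rewrite ffunE xJ ac; apply => //.
    by have := subsetP JW x xJ; rewrite !in_set => /andP[].
  apply/availP => w /h; rewrite ffunE; case: ifP => // wJ _.
  by rewrite (blank_None JW wJ).
move=> [ac /availP h] w /h fw; rewrite ffunE; case: ifP => // _ [ca].
by rewrite ca eqxx in ac.
Qed.

(* Splitting off the set of neighbours of u with colour c: given the rest of  *)
(* the colouring, it is a hard-core sample on G[blank f u c].                 *)
Lemma resample (h : pcol -> R) : \sum_f wt f * h f =
  \sum_(f | c \in palette f u) wt f *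
    \sum_(J : {set T} | (J \subset blank f u c) && stable e J)
      lam ^+ #|J| * h (paint c f J).
Proof.
transitivity (\sum_(f | proper_col f) lam ^+ #|colored f| * h f).
  rewrite [RHS]big_mkcond; apply: eq_bigr => f _; rewrite /wt.
  by case: ifP; rewrite ?mul0r.
rewrite (reindex_onto (fun p => paint c p.1 p.2)
  (fun f => (erase f, stamp f))); last first.
  by move=> f _; apply: paint_erase.
under eq_bigl => p do rewrite [X in _ == X]surjective_pairing erase_paintP.
rewrite /=.
transitivity (\sum_(f | proper_col f && (c \in palette f u))
  \sum_(J : {set T} | (J \subset blank f u c) && stable e J)
    lam ^+ #|colored (paint c f J)| * h (paint c f J)).
  by rewrite pair_big_dep /=; under [RHS]eq_bigl do rewrite -andbA.
rewrite big_mkcondl [RHS]big_mkcond [LHS]big_mkcond; apply: eq_bigr => f _.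
case: ifP => // cf; rewrite /wt; case: ifP => pf; last by rewrite mul0r.
rewrite big_distrr /=; apply: eq_bigr => J /andP[JW _].
by rewrite card_colored_paint // exprD mulrA.
Qed.

(** Resampling conditioned on Q: painting changes colours only inside N(u), so it cannot affect
    Q. *)
Lemma wt_hcZ (Q : pcol -> bool) :
  (forall f g, (forall v, v \notin nb u -> f v = g v) -> Q f = Q g) ->
  forall h : pcol -> R,
  \sum_(f | Q f) wt f * h f =
  \sum_(f | Q f && (c \in palette f u)) wt f *
    \sum_(J : {set T} | (J \subset blank f u c) && stable e J)
      lam ^+ #|J| * h (paint c f J).
Proof.
move=> Qu h; transitivity (\sum_f wt f * ((Q f)%:R * h f)).
  rewrite big_mkcond; apply: eq_bigr => f _.
  by case: (Q f); rewrite ?mul1r ?mul0r ?mulr0.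
rewrite resample [RHS]big_mkcondl; apply: eq_bigr => f cf.
have QJ J : J \subset blank f u c -> Q (paint c f J) = Q f.
  move=> JW; apply: Qu => v vu; rewrite ffunE; case: ifP => // vJ.
  by move: vu; have := subsetP JW v vJ; rewrite in_set => /andP[->].
case: ifP => Qf; last first.
  rewrite big1 ?mulr0 // => J /andP[JW _].
  by rewrite QJ // Qf mul0r mulr0.
congr (_ * _); apply: eq_bigr => J /andP[JW _].
by rewrite QJ // Qf mul1r.
Qed.

End Resampling.

End PartialColorings.

(** * A Gronwall inequality for polynomials *)

Section Gronwall.
Variable R : realType.

(** The drift condition makes exp(-mu x) P(x) nondecreasing on [0, 1]. *)
Lemma horner_gronwall (P : {poly R}) (mu s : R) : 0 <= s -> s <= 1 ->
  (forall x, 0 < x -> x < 1 -> mu * P.[x] <= P^`().[x]) ->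
  P.[s] <= expR (- ((1 - s) * mu)) * P.[1].
Proof.
move=> s0 s1 drift.
pose g (x : R) := expR (- mu * x) * P.[x].
have dg (x : R) : is_derive x (1 : R) g
    (expR (- mu * x) * (P^`().[x] - mu * P.[x])).
  have -> : g = (fun x => expR (- mu * x)) * horner P by [].
  apply: is_derive_eq; rewrite /GRing.scale /=; ring.
have : g s <= g 1.
  apply: (@ger0_derive1_ndecr _ g 0 1) => //.
  - move=> x; rewrite in_itv /= => /andP[x0 x1].
    rewrite derive1E derive_val mulr_ge0 ?expR_ge0 // subr_ge0; exact: drift.
  - apply: derivable_within_continuous => x _; by case: (dg x).
rewrite /g mulr1 => h.
have -> : P.[s] = expR (mu * s) * (expR (- mu * s) * P.[s]).
  by rewrite mulrA -expRD mulNr subrr expR0 mul1r.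
apply: le_trans (ler_wpM2l (expR_ge0 _) h) _.
rewrite mulrA -expRD le_eqVlt; apply/orP; left; apply/eqP; congr (expR _ * _).
ring.
Qed.

End Gronwall.

(** * Bounds for the two kinds of badness at one vertex *)

Section LocalBounds.
Variables (R : realType) (T C : finType) (e : rel T) (lam : R).
Hypotheses (e_sym : symmetric e) (lam_gt0 : 0 < lam).

Local Notation pcol := {ffun T -> option C}.
Implicit Types (f g : pcol) (c : C) (J W : {set T}).
Local Notation wt := (@wt R T C e lam).
Local Notation nb := (nb e).
Local Notation palette := (@palette T C e).
Local Notation blank := (@blank T C e).
Local Notation hcZ := (hcZ e lam).
Local Notation hcM := (hcM e lam).

Variables (u : T) (Q : pcol -> bool).
Hypothesis Q_out :
  forall f g, (forall v, v \notin nb u -> f v = g v) -> Q f = Q g.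

Lemma card_stamp_paint c f J : c \in palette f u -> J \subset blank f u c ->
  #|stamp e u c (paint c f J)| = #|J|.
Proof.
move=> cf JW; congr #|pred_of_set _|; apply/setP => v; rewrite in_set ffunE.
have [vJ|vJ] := boolP (v \in J).
  by have := subsetP JW v vJ; rewrite in_set => /andP[->]; rewrite eqxx.
move: cf; rewrite palette_avail => /eqP/setP/(_ v).
by rewrite in_set in_set0.
Qed.

Section Tail.
Variables b gam : R.
Hypothesis gam_gt0 : 0 < gam.
Hypothesis occ : forall W, W \subset nb u -> hcZ W <= b + gam * hcM W.

(* The hard-core measure tilted by s^|palette| still satisfies the averaged   *)
(* local occupancy inequality, because lowering the weight of the empty set   *)
(* to s <= 1 only lowers the partition function.                              *)
Lemma tilted_occupancy c s : 0 <= s -> s <= 1 ->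
  \sum_(f | Q f) wt f * s ^+ #|palette f u| <=
  \sum_(f | Q f) wt f * (b * ((c \in palette f u)%:R * s ^+ #|palette f u|.-1)
                    + gam * (#|stamp e u c f|%:R * s ^+ #|palette f u|)).
Proof.
move=> s0 s1; rewrite -subr_ge0 -sumrB.
pose h f := b * ((c \in palette f u)%:R * s ^+ #|palette f u|.-1)
  + gam * (#|stamp e u c f|%:R * s ^+ #|palette f u|) - s ^+ #|palette f u|.
under eq_bigr => f _ do rewrite -mulrBr -/(h f).
rewrite (wt_hcZ lam e_sym c Q_out h); apply: sumr_ge0 => f /andP[_ cf].
apply: mulr_ge0; first exact: wt_ge0.
set W := blank f u c; set k := #|palette f u|.-1.
have Ek : #|palette f u| = k.+1.
  by rewrite /k prednK //; apply/card_gt0P; exists c.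
(* A nonempty J removes c from the palette, leaving k colours; the empty J keeps all k + 1.
   Factoring out s^k, the sum over J is b + gam M - Z + (1 - s). *)
have hP J : (J \subset W) && stable e J -> lam ^+ #|J| * h (paint c f J) =
    s ^+ k * (gam * (#|J|%:R * lam ^+ #|J|) - lam ^+ #|J|
              + (J == set0)%:R * (b + 1 - s)).
  move=> /andP[JW _]; rewrite /h card_stamp_paint // palette_paint //.
  case: eqP => [->|/eqP J0].
    rewrite cf Ek /= !cards0 expr0 exprS; ring.
  rewrite setD11 (_ : #|palette f u :\ c| = k); last first.
    by move: Ek; rewrite (cardsD1 c) cf => -[].
  rewrite mulr0n; ring.
rewrite (eq_bigr _ hP) -mulr_sumr; apply: mulr_ge0; first exact: exprn_ge0.
rewrite !big_split /= sumrN -mulr_sumr.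
rewrite [X in _ + X](bigD1 set0) ?sub0set ?stable0 //= eqxx mul1r.
rewrite [X in _ + (_ + X)]big1 ?addr0; last first.
  by move=> J /andP[_ /negPf ->]; rewrite mul0r.
have WN : W \subset nb u by apply/subsetP=> v; rewrite in_set => /andP[].
have := occ WN; rewrite /hcZ /hcM; lra.
Qed.

Lemma sum_stamp f : (\sum_c #|stamp e u c f| <= #|nb u|)%N.
Proof.
rewrite -sum1_card; under eq_bigr do rewrite -sum1_card.
rewrite (exchange_big_dep (mem (nb u))) /=; last first.
  by move=> c v _; rewrite in_set => /andP[].
apply: leq_sum => v vu.
rewrite (eq_bigl (fun c => f v == Some c)); last first.
  by move=> c; rewrite in_set -(andTb (f v == _)); congr andb.
case: (f v) => [a|]; last by rewrite big_pred0.
by rewrite (big_pred1 a) // => c; rewrite eq_sym.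
Qed.

Variables (Delta : nat) (mu : R).
Hypotheses (b_gt0 : 0 < b) (mu_ge0 : 0 <= mu).
Hypothesis deg_u : (#|nb u| <= Delta)%N.
Hypothesis colors_large : b * mu <= #|C|%:R - gam * Delta%:R.

(** The unnormalised generating function of the palette size on the event Q. *)
Definition palette_poly : {poly R} :=
  \sum_(f | Q f) wt f *: 'X^#|palette f u|.

Lemma palette_polyE s :
  palette_poly.[s] = \sum_(f | Q f) wt f * s ^+ #|palette f u|.
Proof.
by rewrite horner_sum; apply: eq_bigr => f _; rewrite hornerZ hornerXn.
Qed.

(** Summing [tilted_occupancy] over the colours gives q P <= b P' + gam Delta P, since each
    neighbour carries at most one colour; then [colors_large] applies. *)
Lemma palette_poly_drift s : 0 <= s -> s <= 1 ->
  mu * palette_poly.[s] <= palette_poly^`().[s].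
Proof.
move=> s0 s1.
have P0 : 0 <= palette_poly.[s].
  rewrite palette_polyE; apply: sumr_ge0 => f _.
  by rewrite mulr_ge0 ?wt_ge0 ?exprn_ge0.
have dE : palette_poly^`().[s] =
    \sum_(f | Q f) wt f * (#|palette f u|%:R * s ^+ #|palette f u|.-1).
  rewrite raddf_sum horner_sum; apply: eq_bigr => f _.
  by rewrite /= derivZ derivXn hornerZ hornerMn hornerXn mulr_natl.
have : #|C|%:R * palette_poly.[s] <=
    b * palette_poly^`().[s] + gam * Delta%:R * palette_poly.[s].
  have -> : #|C|%:R * palette_poly.[s] = \sum_(c : C) palette_poly.[s].
    by rewrite sumr_const mulr_natl.
  rewrite palette_polyE.
  apply: (@le_trans _ _ (\sum_c \sum_(f | Q f)
      wt f * (b * ((c \in palette f u)%:R * s ^+ #|palette f u|.-1)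
              + gam * (#|stamp e u c f|%:R * s ^+ #|palette f u|)))).
    by apply: ler_sum => c _; apply: tilted_occupancy.
  rewrite exchange_big /= dE mulr_sumr mulr_sumr -big_split /=.
  apply: ler_sum => f _.
  rewrite -mulr_sumr big_split /= -!mulr_sumr -!mulr_suml.
  have -> : \sum_c (c \in palette f u)%:R = #|palette f u|%:R :> R.
    by rewrite -natr_sum; congr _%:R; rewrite -sum1_card [RHS]big_mkcond.
  rewrite mulrDr [b * (wt f * _)]mulrCA lerD2l.
  rewrite -[gam * _ * _]mulrA [Delta%:R * _]mulrCA [gam * (wt f * _)]mulrCA.
  apply: ler_wpM2l; first exact: wt_ge0.
  rewrite ler_pM2l //; apply: ler_wpM2r; first exact: exprn_ge0.
  by rewrite -natr_sum ler_nat (leq_trans (sum_stamp f)).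
move=> h; rewrite -(ler_pM2l b_gt0).
have := ler_wpM2r P0 colors_large; lra.
Qed.

(** Markov's inequality for s^|palette| with s = exp(-1/2): the exponent is mu/4 - (1 - s) mu, and s
    <= 5/8 makes it at most -mu/8. *)
Lemma small_palette :
  \sum_(f | Q f && (#|palette f u|%:R < mu / 2)) wt f <=
  expR (- (mu / 8)) * \sum_(f | Q f) wt f.
Proof.
pose s : R := expR (- (1 / 2)).
have s0 : 0 <= s by exact: expR_ge0.
have s_le : s <= 5 / 8.
  have h : (9 / 8) ^+ 4 <= expR (1 / 2) :> R.
    have -> : (1 / 2 : R) = 4%:R * (1 / 8) by field.
    have h := expR_ge1Dx (1 / 8 : R).
    rewrite expRM_natl; apply: lerXn2r; rewrite ?nnegrE ?expR_ge0 //; lra.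
  have : s * expR (1 / 2) = 1 by rewrite /s -expRD addNr expR0.
  nra.
apply: (@le_trans _ _ (expR (mu / 4) * palette_poly.[s])).
  rewrite palette_polyE mulr_sumr big_mkcondr; apply: ler_sum => f _.
  rewrite mulrCA; case: ifP => [lt|_]; last first.
    by rewrite mulr_ge0 ?wt_ge0 // mulr_ge0 ?expR_ge0 ?exprn_ge0.
  rewrite ler_peMr ?wt_ge0 // /s -expRM_natl -expRD.
  by apply: le_trans (expR_ge1Dx _); lra.
have s1 : s <= 1 by lra.
have drift x : 0 < x -> x < 1 -> mu * palette_poly.[x] <= palette_poly^`().[x].
  by move=> /ltW x0 /ltW; apply: palette_poly_drift.
apply: le_trans (ler_wpM2l (expR_ge0 _) (horner_gronwall s0 s1 drift)) _.
have -> : palette_poly.[1] = \sum_(f | Q f) wt f.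
  by rewrite palette_polyE; apply: eq_bigr => f _; rewrite expr1n mulr1.
rewrite mulrA -expRD; apply: ler_wpM2r.
  by apply: sumr_ge0 => f _; apply: wt_ge0.
rewrite ler_expR.
have := ler_wpM2l mu_ge0 s_le; lra.
Qed.

End Tail.

(** Given the rest of the colouring, c stays in the palette only when the resampled set is empty,
    with probability 1/Z; this is at most [del] once the blank set has d vertices. *)
Lemma many_blank (d : nat) (del : R) c : 0 <= del ->
  (forall W, W \subset nb u -> (d <= #|W|)%N -> 1 <= del * hcZ W) ->
  \sum_(f | [&& Q f, c \in palette f u & (d <= #|blank f u c|)%N]) wt f <=
  del * \sum_(f | Q f) wt f.
Proof.
move=> del0 Zd.
pose h f : R := del - ((c \in palette f u) && (d <= #|blank f u c|)%N)%:R.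
suff : 0 <= \sum_(f | Q f) wt f * h f.
  under eq_bigr do rewrite mulrBr mulrC.
  rewrite sumrB -mulr_sumr subr_ge0; apply: le_trans.
  rewrite big_mkcondr; apply: ler_sum => f _.
  by case: ifP => _; rewrite ?mulr1 ?mulr0.
rewrite (wt_hcZ lam e_sym c Q_out h); apply: sumr_ge0 => f /andP[_ cf].
apply: mulr_ge0; first exact: wt_ge0.
set W := blank f u c.
have hP J : (J \subset W) && stable e J -> lam ^+ #|J| * h (paint c f J) =
    del * lam ^+ #|J| - (J == set0)%:R * (d <= #|W|)%N%:R.
  move=> /andP[JW _]; rewrite /h palette_paint //.
  case: eqP => [->|/eqP J0].
    by rewrite paint0 cf cards0 expr0 !mul1r mulr1.
  by rewrite setD11 mulr0n subr0 mul0r subr0 mulrC.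
rewrite (eq_bigr _ hP) sumrB -mulr_sumr.
rewrite [X in _ - X](bigD1 set0) ?sub0set ?stable0 //= eqxx mul1r.
rewrite [X in _ - (_ + X)]big1 ?addr0; last first.
  by move=> J /andP[_ /negPf ->]; rewrite mul0r.
have WN : W \subset nb u by apply/subsetP=> v; rewrite in_set => /andP[].
rewrite subr_ge0 -/(hcZ W); case: (leqP d #|W|) => dW; first exact: Zd.
by rewrite mulr_ge0 // ltW // hcZ_gt0.
Qed.

End LocalBounds.

(** * Vertices within distance three *)

Section Distance.
Variables (T : finType) (e : rel T) (Delta : nat).
Hypotheses (e_sym : symmetric e) (deg : forall u, (#|nb e u| <= Delta)%N).
Implicit Types u v w : T.

Definition near2 u := \bigcup_(w in nb e u) (nb e w :\ u).

(* Every vertex other than u at distance at most 3 from u lies in near3 u.    *)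
Definition near3 u :=
  nb e u :|: near2 u :|: \bigcup_(w in near2 u) (nb e w :\: nb e u).

Lemma card_bigcup_le (A : {set T}) (F : T -> {set T}) k :
  (forall w, w \in A -> (#|F w| <= k)%N) ->
  (#|\bigcup_(w in A) F w| <= #|A| * k)%N.
Proof.
move=> Fk; apply: (@leq_trans (\sum_(w in A) #|F w|)%N); last first.
  by rewrite -sum_nat_const; apply: leq_sum.
elim/big_rec2: _ => [|w m B _ IH]; first by rewrite cards0.
by apply: leq_trans (leq_card_setU _ _) _; rewrite leq_add2l.
Qed.

(** The three layers give Delta + Delta (Delta - 1) + Delta (Delta - 1)^2 = Delta^3 - Delta^2 +
    Delta. *)
Lemma card_near3 u : (1 < Delta)%N -> (#|near3 u| <= (Delta ^ 3).-1)%N.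
Proof.
move=> D1.
have c2 : (#|near2 u| <= Delta * Delta.-1)%N.
  apply: leq_trans (card_bigcup_le (k := Delta.-1) _) _.
    move=> w; rewrite inE => euw; have := deg w.
    by rewrite (cardsD1 u) inE e_sym euw; lia.
  by rewrite leq_mul2r deg orbT.
have c3 : (#|\bigcup_(w in near2 u) (nb e w :\: nb e u)|
           <= Delta * Delta.-1 * Delta.-1)%N.
  apply: leq_trans (card_bigcup_le (k := Delta.-1) _) _.
    move=> w /bigcupP[x xu]; rewrite !inE => /andP[_ exw].
    have := deg w; rewrite -(cardsID (nb e u) (nb e w)).
    have : (0 < #|nb e w :&: nb e u|)%N.
      by apply/card_gt0P; exists x; rewrite inE xu inE e_sym exw.
    lia.
  by rewrite leq_mul2r c2 orbT.
rewrite /near3; apply: leq_trans (leq_card_setU _ _) _.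
have c1 := leq_trans (leq_card_setU _ _) (leq_add (deg u) c2).
apply: leq_trans (leq_add c1 c3) _.
case: Delta D1 => [|[|k]] // _; rewrite /= !expnS expn0; nia.
Qed.

Lemma near3_nb u v x :
  v != u -> v \notin near3 u -> x \in nb e v -> x \notin nb e u.
Proof.
move=> vu vn xv; apply: contra vn => xu; rewrite !in_setU; apply/orP; left.
apply/orP; right; apply/bigcupP; exists x => //.
by rewrite !inE vu e_sym; rewrite inE in xv.
Qed.

Lemma near3_nb2 u v w x : v \notin near3 u -> w \in nb e v ->
  x \in nb e w -> x \notin nb e u.
Proof.
move=> vn wv xw; apply: contra vn => xu; rewrite !in_setU.
have [vu //|vu] := boolP (v \in nb e u); rewrite orFb.
rewrite !inE in wv xw xu vu *.
have wu : w != u by apply: contraNneq vu => <-; rewrite e_sym.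
apply/orP; right; apply/bigcupP; exists w; last by rewrite !inE vu e_sym.
by apply/bigcupP; exists x; rewrite !inE ?wu // e_sym.
Qed.

End Distance.

(** * From rare badness to a proper colouring *)

Section Coloring.
Variables (R : realType) (T C : finType) (e : rel T) (lam : R) (c0 : C).
Hypotheses (e_sym : symmetric e) (e_irr : irreflexive e) (lam_gt0 : 0 < lam).
Local Notation pcol := {ffun T -> option C}.
Implicit Types (f g : pcol) (c : C) (u v : T) (W : {set T}).

Variables (V : {set T}) (Delta d : nat) (b gam mu del : R).
Hypotheses (b_gt0 : 0 < b) (gam_gt0 : 0 < gam) (del_ge0 : 0 <= del).
Hypothesis deg : forall u, (#|nb e u| <= Delta)%N.
Hypothesis occ : forall u W, u \in V -> W \subset nb e u ->
  hcZ e lam W <= b + gam * hcM e lam W.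
Hypothesis Z_large : forall u W, u \in V -> W \subset nb e u -> (d <= #|W|)%N ->
  1 <= del * hcZ e lam W.
Hypothesis colors_large : b * mu <= #|C|%:R - gam * Delta%:R.

Definition bad u f := (#|palette e f u|%:R < mu / 2) ||
  [exists c, (c \in palette e f u) && (d <= #|blank e f u c|)%N].

Lemma bad_wt u (Q : pcol -> bool) : u \in V -> 0 <= mu ->
  (forall f g, (forall v, v \notin nb e u -> f v = g v) -> Q f = Q g) ->
  \sum_(f | Q f && bad u f) wt e lam f <=
  (expR (- (mu / 8)) + #|C|%:R * del) * \sum_(f | Q f) wt e lam f.
Proof.
move=> uV mu0 Q_out.
have h1 := small_palette e_sym lam_gt0 Q_out gam_gt0
  (fun W => @occ u W uV) b_gt0 mu0 (deg u) colors_large.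
have h2 c := many_blank e_sym lam_gt0 Q_out c del_ge0
  (fun W => @Z_large u W uV).
rewrite mulrDl.
apply: le_trans (lerD h1 (_ : _ <= #|C|%:R * del * _)); last first.
  rewrite -mulrA mulr_natl -sumr_const; apply: ler_sum => c _; exact: h2 c.
rewrite (exchange_big_dep Q) /=; last by move=> c f _ /andP[].
rewrite big_mkcondr [X in _ <= X + _]big_mkcondr -big_split /=.
apply: ler_sum => f Qf; rewrite /bad Qf.
have w0 := wt_ge0 e lam_gt0 f.
case: ifP => [/orP[->|/existsP[c cP]]|_]; last first.
  by apply: addr_ge0; [case: ifP|apply: sumr_ge0].
  rewrite (bigD1 c) //= addrCA lerDl; apply: addr_ge0; last by apply: sumr_ge0.
  by case: ifP.
by rewrite lerDl; apply: sumr_ge0.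
Qed.

(** Badness at v reads colours only at distance at most 2 from v, and these vertices miss N(u). *)
Lemma bad_local u v f g : v != u -> v \notin near3 e u ->
  (forall x, x \notin nb e u -> f x = g x) -> bad v f = bad v g.
Proof.
move=> vu vn fg.
have eqp : palette e f v = palette e g v.
  apply/setP => c; rewrite !in_set; apply: eq_forallb_in => w wv.
  by rewrite fg // (near3_nb e_sym vu vn).
rewrite /bad eqp; congr (_ || _).
apply: eq_existsb => c; congr (_ && (_ <= _)%N).
apply: eq_card => w; rewrite !in_set.
have [wv|//] := boolP (e v w); rewrite /= fg; last first.
  by apply: (near3_nb e_sym vu vn); rewrite inE.
congr andb; apply: eq_forallb_in => x xw.
by rewrite fg // (near3_nb2 e_sym vn _ xw) // inE.
Qed.

Lemma exp_pow_le (m : nat) : (1 < m)%N ->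
  expR (-1) <= (1 - m%:R^-1) ^+ m.-1 :> R.
Proof.
case: m => [|[|k]] // _ /=.
have k1 : 0 < k.+1%:R :> R by rewrite ltr0n.
have -> : -1 = k.+1%:R * (- k.+1%:R^-1) :> R by rewrite mulrN divff // gt_eqF.
rewrite expRM_natl; apply: lerXn2r; rewrite ?nnegrE ?expR_ge0 //.
  by rewrite subr_ge0 invf_le1 ?ltr0n // ler1n.
have h : 1 + k.+1%:R^-1 <= expR (k.+1%:R^-1) :> R by apply: expR_ge1Dx.
rewrite expRN; apply: (@le_trans _ _ (1 + k.+1%:R^-1)^-1).
  by rewrite lef_pV2 // posrE ?expR_gt0 // addr_gt0 // invr_gt0.
rewrite -[k.+2%:R]natr1 le_eqVlt; apply/orP; left; apply/eqP.
have k0 : 0 <= k%:R :> R by [].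
by field; apply/andP; split; rewrite gt_eqF //; lra.
Qed.

Lemma coloring_of_occupancy : (1 < Delta)%N -> (0 < d)%N ->
  4 * d%:R <= mu / 2 ->
  (expR (- (mu / 8)) + #|C|%:R * del) * expR 1 * (Delta ^ 3)%:R <= 1 ->
  exists F : T -> C, forall v w, v \in V -> w \in V -> e v w -> F v != F w.
Proof.
move=> D1 d_gt0 mu_large p_small.
have mu0 : 0 <= mu.
  have : 0 <= d%:R :> R by []. lra.
set p := _ + _ in p_small.
set m := (Delta ^ 3)%N in p_small.
have m1 : (1 < m)%N by rewrite -(exp1n 3) ltn_exp2r.
have mR : 1 < m%:R :> R by rewrite ltr1n.
have m0 : 0 < m%:R :> R by apply: lt_trans mR.
(* With D = m - 1 this x gives (1 - x) x^D >= 1/(e m), by [exp_pow_le]. *)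
pose x : R := 1 - m%:R^-1.
have x0 : 0 < x by rewrite subr_gt0 invf_lt1.
have x1 : x <= 1 by rewrite gerBl invr_ge0 ltW.
have p_le : p <= (1 - x) * x ^+ m.-1.
  rewrite /x opprB addrCA subrr addr0.
  apply: (@le_trans _ _ (m%:R^-1 * expR (-1))); last first.
    by rewrite ler_pM2l ?invr_gt0 // exp_pow_le.
  rewrite expRN -invfM -[leRHS]mul1r ler_pdivlMr ?mulr_gt0 ?expR_gt0 //.
  by rewrite mulrCA mulrA [_ * p]mulrC mulrAC.
have wt_pos : 0 < \sum_(f : {ffun T -> option C}) wt e lam f.
  rewrite (bigD1 [ffun=> None]) //= ltr_wpDr //.
    by apply: sumr_ge0 => f _; apply: wt_ge0.
  rewrite /wt ifT ?exprn_gt0 //.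
  by apply/proper_colP => u v c _; rewrite ffunE.
have [|f wf hf] := local_lemma (V := V) (B := bad)
    (fun f => wt_ge0 e lam_gt0 f) x0 x1 p_le
    (fun u _ => card_near3 e_sym deg u D1) _ wt_pos.
  move=> u S uV _ uS dis; apply: bad_wt => // f g fg.
  apply: eq_forallb_in => v vS.
  rewrite (@bad_local u v f g) //; first by apply: contraNneq uS => <-.
  by apply: contraTN vS => vn; rewrite (disjointFl dis vn).
have pf : proper_col e f.
  by move: wf; rewrite /wt; case: ifP => //; rewrite ltxx.
pose U := [set v in V | f v == None].
have [||g [gL gU]] :=
  @list_coloring T C e (palette e f) U d c0 e_sym d_gt0 _ _ e_irr.
- move=> v; rewrite inE => /andP[/hf + _]; rewrite negb_or => /andP[+ _].
  rewrite -leNgt => h; have := le_trans mu_large h.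
  by rewrite -natrM ler_nat.
- move=> v c; rewrite inE => /andP[/hf + _]; rewrite negb_or => /andP[_].
  rewrite negb_exists => /forallP/(_ c) + cL; rewrite cL /= -ltnNge => /ltnW.
  apply: leq_trans; apply: subset_leq_card; apply/subsetP => w.
  by rewrite !in_set => /and3P[/andP[_ ->] -> ->].
have gN v w : v \in U -> e v w -> f w <> Some (g v).
  by move=> /gL; rewrite inE => /availP; apply.
exists (fun v => if f v is Some c then c else g v) => v w vV wV evw.
case fv: (f v) => [a|]; case fw: (f w) => [a'|].
- move/proper_colP: pf => /(_ v w a evw fv) h.
  by apply: contra_notN h => /eqP ->.
- apply/eqP => ag; apply: (gN w v); rewrite ?inE ?wV ?fw ?fv ?ag //.
  by rewrite e_sym.
- by apply/eqP => ag; apply: (gN v w); rewrite ?inE ?vV ?fw ?fv ?ag.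
- by apply: gU; rewrite ?inE ?vV ?wV ?fv ?fw.
Qed.

End Coloring.

(** * Translation from graphs to edge relations *)

Section GraphRelation.
Variables (T : finType) (G : graph T).
Implicit Types (u v : T) (W J : {set T}).

Definition edge_rel : rel T := fun u v => [set u; v] \in eset G.

Lemma edge_rel_sym : symmetric edge_rel.
Proof. by move=> u v; rewrite /edge_rel setUC. Qed.

Lemma edge_rel_irr : irreflexive edge_rel.
Proof.
move=> u; apply/negbTE/negP => uE.
by have /andP[_] := forall_inP (graphP G) _ uE; rewrite setUid cards1.
Qed.

Lemma edge_rel_vset u v : edge_rel u v -> (u \in vset G) && (v \in vset G).
Proof.
move=> uE; have /andP[/subsetP h _] := forall_inP (graphP G) _ uE.
by rewrite !h // !inE eqxx ?orbT.
Qed.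

Lemma card_nbhd_le u : (#|nb edge_rel u| <= max_degree G)%N.
Proof.
have [uV|uV] := boolP (u \in vset G).
  exact: (@leq_bigmax_cond _ (mem (vset G)) (fun u => #|nbhd G u|)).
rewrite (_ : nb edge_rel u = set0) ?cards0 //.
apply/setP => v; rewrite !inE; apply/negbTE.
by apply: contra uV => /edge_rel_vset/andP[].
Qed.

Lemma vset_induced_nbhd u W : W \subset nbhd G u ->
  vset (induced (induced G (nbhd G u)) W) = W.
Proof.
move=> Wu; rewrite /vset /= /vset /=; apply/setIidPl; rewrite subsetI Wu /=.
apply/subsetP => v /(subsetP Wu); rewrite inE => /edge_rel_vset.
by case/andP.
Qed.

Lemma independent_induced_nbhd u W J : W \subset nbhd G u ->
  independent (induced (induced G (nbhd G u)) W) J =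
  (J \subset W) && stable edge_rel J.
Proof.
move=> Wu; rewrite /independent vset_induced_nbhd //; apply: andb_id2l => JW.
apply/forall_inP/stableP => [h x y xJ yJ|h E].
  apply/negP => xyE; have sJ : [set x; y] \subset J.
    by rewrite subUset !sub1set xJ.
  have sW := subset_trans sJ JW.
  suff xyW : [set x; y] \in eset (induced (induced G (nbhd G u)) W).
    by have := h _ xyW; rewrite sJ.
  by rewrite !inE sW (subset_trans sW Wu) !andbT.
rewrite !inE => /andP[/andP[EG _] _].
have /andP[_ /cards2P[x [y [_ Exy]]]] := forall_inP (graphP G) _ EG.
rewrite Exy in EG *; rewrite subUset !sub1set; apply/negP => /andP[xJ yJ].
by have := h x y xJ yJ; rewrite /edge_rel EG.
Qed.

Variables (R : realType) (lam : R).

Lemma indep_poly_horner u W : W \subset nbhd G u ->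
  (indep_poly R (induced (induced G (nbhd G u)) W)).[lam] = hcZ edge_rel lam W.
Proof.
move=> Wu; rewrite /indep_poly horner_sum /hcZ.
under eq_bigl do rewrite independent_induced_nbhd //.
by apply: eq_bigr => J _; rewrite hornerXn.
Qed.

Lemma indep_poly_deriv_horner u W : W \subset nbhd G u ->
  lam * (indep_poly R (induced (induced G (nbhd G u)) W))^`().[lam]
  = hcM edge_rel lam W.
Proof.
move=> Wu; rewrite /indep_poly raddf_sum horner_sum mulr_sumr /hcM.
under eq_bigl do rewrite independent_induced_nbhd //.
apply: eq_bigr => J _; rewrite /= derivXn hornerMn hornerXn -mulr_natl mulrCA.
by case: #|J| => [|k]; rewrite ?mul0r //= -exprS.
Qed.

Hypothesis lam_gt0 : 0 < lam.

Lemma local_occupancy_hcZ beta gam u W : local_occupancy G lam beta gam ->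
  u \in vset G -> W \subset nbhd G u ->
  hcZ edge_rel lam W <= beta * (lam / (1 + lam)) + gam * hcM edge_rel lam W.
Proof.
move=> occ uV Wu; have := occ u W uV Wu.
rewrite /= indep_poly_horner // indep_poly_deriv_horner //.
have Z0 := hcZ_gt0 edge_rel lam_gt0 W.
by rewrite mul1r [gam * _]mulrA -mulrDl ler_pdivlMr // mul1r.
Qed.

(** The maximum covers subgraphs with exactly d vertices; larger W follow from a d-subset, as Z
    grows with the vertex set. *)
Lemma max_inv_Z_hcZ (d : nat) del u W : max_inv_Z G d lam <= del ->
  u \in vset G -> W \subset nbhd G u -> (d <= #|W|)%N ->
  1 <= del * hcZ edge_rel lam W.
Proof.
move=> hmax uV Wu dW.
have [s [s_uniq s_size sW]] := card_geqP dW.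
pose W' := [set x in s].
have cW' : #|W'| = d by rewrite cardsE (card_uniqP s_uniq).
have W'W : W' \subset W by apply/subsetP => x; rewrite inE => /sW.
have W'u := subset_trans W'W Wu.
have Z0 := hcZ_gt0 edge_rel lam_gt0 W'.
have hdel : 1 / hcZ edge_rel lam W' <= del.
  apply: le_trans hmax; rewrite -(indep_poly_horner W'u) /max_inv_Z.
  apply: le_trans (le_bigmax_cond _ _ uV).
  apply: (le_bigmax_cond _ (fun F => 1 / (indep_poly R F).[lam])).
  rewrite vset_induced_nbhd // cW' eqxx andbT /subgraph.
  rewrite subsetIr /=; apply/subsetP => E; rewrite inE => /andP[] //.
have del0 : 0 <= del by apply: le_trans hdel; rewrite divr_ge0 // ltW.
rewrite ler_pdivrMr // in hdel; apply: le_trans hdel _.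
by apply: ler_wpM2l => //; apply: hcZS.
Qed.

Lemma chromatic_number_le (q : nat) (f : T -> 'I_q) :
  (forall v w, v \in vset G -> w \in vset G -> edge_rel v w -> f v != f w) ->
  (chromatic_number G <= q)%N.
Proof.
move=> hf; rewrite /chromatic_number; case: ex_minnP => m _; apply.
apply/existsP; exists [ffun x => f (val x)].
apply/forallP => x; apply/forallP => y; apply/implyP => xy.
by rewrite !ffunE; apply: hf => //; apply: valP.
Qed.

End GraphRelation.

(** * Choice of constants and the case of maximum degree one *)

Theorem theorem5p5 (R : realType) (T : finType) (G : graph T) (Delta : nat)
    (lambda beta gamma : R) (q d : nat)
    (hDelta : Delta = max_degree G) (hDelta1 : (1 <= Delta)%N)
    (hlambda : 0 < lambda) (hbeta : 0 < beta) (hgamma : 0 < gamma)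
    (hocc : local_occupancy G lambda beta gamma)
    (hq : (0 < q)%N)
    (hd : d%:R >= 2 / expR 1 * ln (2 * expR 1 * Delta%:R ^+ 3) :> R)
    (hsize : (1 + lambda) / (beta * lambda) * (q%:R - gamma * Delta%:R)
             >= 4 * expR 1 * d%:R)
    (hmax : max_inv_Z G d lambda <= 1 / (2 * expR 1 * q%:R * Delta%:R ^+ 3)) :
  (chromatic_number G <= q)%N.
Proof.
have e2 : 2 <= expR 1 :> R by have := expR_ge1Dx (1 : R).
have e0 : 0 < expR 1 :> R := expR_gt0 1.
have D1 : 1 <= Delta%:R :> R by rewrite ler1n.
have D3 : 1 <= Delta%:R ^+ 3 :> R by apply: exprn_ege1.
have q0 : 0 < q%:R :> R by rewrite ltr0n.
set X := 2 * expR 1 * Delta%:R ^+ 3 in hd.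
have X1 : 1 < X by rewrite /X; nra.
have d_gt0 : (0 < d)%N.
  rewrite -(ltr0n R); apply: lt_le_trans hd.
  by rewrite mulr_gt0 ?divr_gt0 // ln_gt0.
have dR : 1 <= d%:R :> R by rewrite ler1n.
pose b := beta * (lambda / (1 + lambda)).
pose mu : R := 4 * expR 1 * d%:R.
have b0 : 0 < b by rewrite mulr_gt0 // divr_gt0 // addr_gt0.
have hb : b * mu <= q%:R - gamma * Delta%:R.
  have bE : b * ((1 + lambda) / (beta * lambda)) = 1.
    by rewrite /b; field; rewrite !gt_eqF // addr_gt0.
  by have := ler_wpM2l (ltW b0) hsize; rewrite [leRHS]mulrA bE mul1r.
pose c0 : 'I_q := Ordinal hq.
have irr := @edge_rel_irr T G; have sym := @edge_rel_sym T G.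
have deg u : (#|nb (edge_rel G) u| <= Delta)%N by rewrite hDelta card_nbhd_le.
have occ u W := local_occupancy_hcZ (W := W) (u := u) hlambda hocc.
have [D_gt1|D_le1] := ltnP 1 Delta.
  set del := 1 / _ in hmax.
  have del0 : 0 <= del.
    by rewrite divr_ge0 // !mulr_ge0 // ltW // exprn_gt0 //; lra.
  have Zl u W uV Wu dW := max_inv_Z_hcZ (u := u) (W := W) hlambda hmax uV Wu dW.
  have cl : b * mu <= #|'I_q|%:R - gamma * Delta%:R by rewrite card_ord.
  have small : expR (- (mu / 8)) <= X^-1.
    rewrite -[leRHS]lnK ?posrE ?invr_gt0 ?(lt_trans ltr01) // ler_expR.
    rewrite lnV ?posrE ?(lt_trans ltr01) //.
    rewrite lerN2; move: hd; rewrite mulrAC ler_pdivrMr // /mu; lra.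
  have [||f hf] := coloring_of_occupancy c0 sym irr hlambda b0 hgamma del0 deg
    occ Zl cl D_gt1 d_gt0 _ _.
  - rewrite /mu; nra.
  - rewrite card_ord.
    have -> : q%:R * del = X^-1.
      by rewrite /del /X; field; rewrite !gt_eqF //; lra.
    apply: (@le_trans _ _ ((X^-1 + X^-1) * expR 1 * (Delta ^ 3)%:R)).
      apply: ler_wpM2r => //; apply: ler_wpM2r; first exact: ltW.
      by rewrite lerD2r.
    rewrite natrX /X le_eqVlt; apply/orP; left; apply/eqP.
    by field; rewrite !gt_eqF //; lra.
  exact: chromatic_number_le hf.
(* Case Delta = 1. Occupancy of the empty graph gives b >= 1, so q > b mu >= 4, and full lists with
   sparsity 1 suffice. *)
have b1 : 1 <= b.
  have /existsP[u uV] : [exists u, u \in vset G].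
    apply: contraLR hDelta1; rewrite negb_exists => /forallP V0.
    by rewrite hDelta /max_degree big_pred0 // => u; apply/negbTE.
  have := occ u set0 uV (sub0set _).
  have s0 (J : {set T}) :
    (J \subset set0) && stable (edge_rel G) J = (J == set0).
    by rewrite subset0; case: eqP => // ->; rewrite stable0.
  rewrite /hcZ /hcM !(eq_bigl _ _ s0) !big_pred1_eq.
  by rewrite cards0 mul0r mulr0 addr0 expr0.
have q4 : (4 <= q)%N.
  rewrite -(ler_nat R); have := mulr_gt0 hgamma (lt_le_trans ltr01 D1).
  have : 4 <= mu by rewrite /mu; nra.
  nra.
have [||f [_ hf]] := @list_coloring T 'I_q (edge_rel G) (fun=> setT) (vset G) 1
  c0 sym isT _ _ irr.
- by move=> v _; rewrite cardsT card_ord.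
- move=> v c _ _; apply: leq_trans (leq_trans (deg v) D_le1).
  by apply: subset_leq_card; apply/subsetP => w; rewrite !inE => /and3P[].
exact: chromatic_number_le hf.
Qed.
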